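(* Let $c=(2,0)$, let $\mathcal{P}_c$ be the set of all cylindric partitions with profile $c$, and let $F_c(1,q)=\sum_{\Lambda\in\mathcal{P}_c} q^{|\Lambda|}$ be their generating function. Then $$F_c(1,q) = \frac{(-q^2;q^2)_\infty}{(q;q)_\infty}.$$
   Context: A partition is a finite (possibly empty) weakly decreasing sequence of positive integers $\lambda=(\lambda_1\ge\lambda_2\ge\cdots\ge\lambda_s)$; set $\lambda_j=0$ for $j>s$. For $c=(c_1,c_2)$ a pair of nonnegative integers, a cylindric partition with profile $c$ is a pair $\Lambda=(\lambda^{(1)},\lambda^{(2)})$ of partitions such that for all $j\ge 1$, $\lambda^{(1)}_j\ge \lambda^{(2)}_{j+c_2}$ and $\lambda^{(2)}_j\ge\lambda^{(1)}_{j+c_1}$. In particular, for $c=(2,0)$ the conditions are $\lambda^{(1)}_j\ge\lambda^{(2)}_{j}$ and $\lambda^{(2)}_j\ge\lambda^{(1)}_{j+2}$ for all $j\ge1$. The size $|\Lambda|$ is the sum of all the parts of $\lambda^{(1)}$ and $\lambda^{(2)}$. Notation: $(a;q)_\infty=\prod_{i\ge0}(1-aq^i)$, so $(-q^2;q^2)_\infty=\prod_{i\ge 1}(1+q^{2i})$. Identities are between formal power series in $q$. *)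

(* Defs.v *)
From HB Require Import structures.
From mathcomp Require Import all_boot all_order all_algebra.
From mathcomp Require Import finmap all_classical.
From mathcomp Require Import topology.

Set Implicit Arguments.
Unset Strict Implicit.
Unset Printing Implicit Defensive.
Import Order.TTheory GRing.Theory Num.Theory.

Local Open Scope classical_set_scope.
Local Open Scope ring_scope.

Record fps (R : Type) := FPS { fps_coef :> nat -> R }.

HB.instance Definition _ (R : Type) := gen_eqMixin (fps R).
HB.instance Definition _ (R : Type) := gen_choiceMixin (fps R).

Lemma fpsP (R : Type) (f g : fps R) : (f : nat -> R) =1 g -> f = g.
Proof. by case: f g => [f] [g] /= /funext ->. Qed.

Section FpsRing.
Variable R : comUnitRingType.
Implicit Types f g h : fps R.

Definition fps_zero : fps R := FPS (fun=> 0).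
Definition fps_one : fps R := FPS (fun n => (n == 0%N)%:R).
Definition fps_opp f : fps R := FPS (fun n => - f n).
Definition fps_add f g : fps R := FPS (fun n => f n + g n).
Definition fps_mul f g : fps R := FPS (fun n => \sum_(i < n.+1) f i * g (n - i)%N).

Fact fps_addA : associative fps_add.
Proof. by move=> f g h; apply: fpsP => n /=; rewrite addrA. Qed.
Fact fps_addC : commutative fps_add.
Proof. by move=> f g; apply: fpsP => n /=; rewrite addrC. Qed.
Fact fps_add0 : left_id fps_zero fps_add.
Proof. by move=> f; apply: fpsP => n /=; rewrite add0r. Qed.
Fact fps_addN : left_inverse fps_zero fps_opp fps_add.
Proof. by move=> f; apply: fpsP => n /=; rewrite addNr. Qed.

HB.instance Definition _ :=
  GRing.isZmodule.Build (fps R) fps_addA fps_addC fps_add0 fps_addN.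

Definition fps_trunc (N : nat) f : {poly R} := \poly_(i < N) f i.

Lemma coef_fps_trunc_mul (N n : nat) f g : (n < N)%N ->
  (fps_trunc N f * fps_trunc N g)`_n = fps_mul f g n.
Proof.
move=> nN; rewrite coefM /=; apply: eq_bigr => i _; rewrite !coef_poly.
have iN : (i < N)%N by apply: leq_ltn_trans nN; rewrite -ltnS.
by rewrite iN (leq_ltn_trans (leq_subr _ _) nN).
Qed.

Fact fps_mulC : commutative fps_mul.
Proof.
move=> f g; apply: fpsP => n.
by rewrite -!(@coef_fps_trunc_mul n.+1) // mulrC.
Qed.

Fact fps_mulA : associative fps_mul.
Proof.
move=> f g h; apply: fpsP => n.
transitivity ((fps_trunc n.+1 f * fps_trunc n.+1 g * fps_trunc n.+1 h)`_n).
  rewrite -mulrA coefM /=; apply: eq_bigr => i _.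
  by rewrite coef_poly ltn_ord coef_fps_trunc_mul // ltnS leq_subr.
rewrite coefM /=; apply: eq_bigr => i _.
by rewrite coef_fps_trunc_mul // coef_poly ltnS leq_subr.
Qed.

Fact fps_mul1 : left_id fps_one fps_mul.
Proof.
move=> f; apply: fpsP => n /=; rewrite big_ord_recl /= mul1r subn0 big1 ?addr0 //.
by move=> i _; rewrite mul0r.
Qed.

Fact fps_mulDl : left_distributive fps_mul fps_add.
Proof.
move=> f g h; apply: fpsP => n /=; rewrite -big_split /=.
by apply: eq_bigr => i _; rewrite mulrDl.
Qed.

Fact fps_one_neq0 : fps_one != 0.
Proof.
apply/eqP => /(congr1 (fun f : fps R => f 0%N)) /= /eqP.
by rewrite oner_eq0.
Qed.

HB.instance Definition _ :=
  GRing.Zmodule_isComNzRing.Build (fps R)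
    fps_mulA fps_mulC fps_mul1 fps_mulDl fps_one_neq0.

(* [fps_inv_seq f n] lists the coefficients of degree < n of the inverse
   series b, computed by
     b_n = f_0^-1 * ((n == 0) - \sum_(i < n) b_i * f_(n - i)). *)
Fixpoint fps_inv_seq f (n : nat) : seq R :=
  if n is m.+1 then
    let s := fps_inv_seq f m in
    rcons s ((f 0%N)^-1 * ((m == 0%N)%:R - \sum_(i < m) s`_i * f (m - i)%N))
  else [::].

Definition fps_unit : {pred fps R} := fun f => f 0%N \is a GRing.unit.

Definition fps_inv f : fps R :=
  if fps_unit f then FPS (fun n => (fps_inv_seq f n.+1)`_n) else f.

Lemma size_fps_inv_seq f n : size (fps_inv_seq f n) = n.
Proof. by elim: n => //= n IHn; rewrite size_rcons IHn. Qed.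

Lemma nth_fps_inv_seq f m n : (n < m)%N ->
  (fps_inv_seq f m)`_n = (fps_inv_seq f n.+1)`_n.
Proof.
elim: m => // m IHm; rewrite ltnS leq_eqVlt => /predU1P[-> //|nm].
by rewrite [LHS]nth_rcons size_fps_inv_seq nm IHm.
Qed.

Fact fps_mulVx : {in fps_unit, left_inverse 1 fps_inv *%R}.
Proof.
move=> f uf; apply: fpsP => n.
have fu : fps_unit f := uf.
rewrite /fps_inv fu -[LHS]/(fps_mul _ _ n) /= big_ord_recr /= subnn.
rewrite nth_rcons size_fps_inv_seq ltnn eqxx mulrAC mulVr // mul1r.
rewrite [X in X + _](_ : _ = \sum_(i < n) (fps_inv_seq f n)`_i * f (n - i)%N).
  by rewrite addrC subrK.
by apply: eq_bigr => i _; rewrite (@nth_fps_inv_seq _ n i).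
Qed.

Fact fps_unitPl f g : g * f = 1 -> fps_unit f.
Proof.
move=> /(congr1 (fun h : fps R => h 0%N)).
rewrite -[LHS]/(fps_mul _ _ 0%N) /= big_ord1 subn0 => gf.
by apply/unitrPr; exists (g 0%N); rewrite mulrC.
Qed.

Fact fps_inv_out : {in [predC fps_unit], fps_inv =1 id}.
Proof.
move=> f nuf; have {}nuf : ~~ fps_unit f := nuf.
by rewrite /fps_inv (negbTE nuf).
Qed.

HB.instance Definition _ :=
  GRing.ComNzRing_hasMulInverse.Build (fps R) fps_mulVx fps_unitPl fps_inv_out.

Definition fpsX : fps R := FPS (fun n => (n == 1%N)%:R).

(* Coefficientwise limit of a sequence of series, for the discrete topology on
   coefficients; a coefficient that does not stabilise gets the value 0. *)
Definition fps_lim (u : nat -> fps R) : fps R :=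
  FPS (fun n => xget 0 [set c | \forall N \near \oo, u N n = c]).

Definition qpoch_inf (a q : fps R) : fps R :=
  fps_lim (fun N => \prod_(i < N) (1 - a * q ^+ i)).

(* The sum of q ^+ wt x over x in A. It is meaningful when A has finitely many
   elements of each weight; otherwise the affected coefficients are 0. *)
Definition genfun (T : choiceType) (A : set T) (wt : T -> nat) : fps R :=
  FPS (fun n => \sum_(x \in A) (fpsX ^+ wt x) n).

Lemma fps_coefM f g n : (f * g) n = \sum_(i < n.+1) f i * g (n - i)%N.
Proof. by []. Qed.

Lemma fps_coefXn m n : (fpsX ^+ m) n = (n == m)%:R.
Proof.
elim: m n => [|m IHm] n; first by rewrite expr0.
rewrite exprS fps_coefM; case: n => [|n].
  by rewrite big_ord1 /= mul0r.
rewrite !big_ord_recl /= mul0r mul1r add0r IHm big1 ?addr0 /bump /=.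
  by rewrite subn1 eqSS.
by move=> i _; rewrite mul0r.
Qed.

Lemma fps_limE (u : nat -> fps R) n c :
  (\forall N \near \oo, u N n = c) -> fps_lim u n = c.
Proof.
move=> uc; apply: xget_unique => // d ud.
by have [N [<- <-]] : exists N, u N n = d /\ u N n = c
  by apply: (@filter_ex _ (nbhs \oo)); near do split.
Unshelve. all: by end_near. Qed.

Lemma fps_coefXn_small f m n : f 0%N = 0 -> (n < m)%N -> (f ^+ m) n = 0.
Proof.
move=> f0; elim: m n => // m IHm n nm; rewrite exprS fps_coefM.
rewrite big_ord_recl f0 mul0r add0r big1 // => i _.
rewrite IHm ?mulr0 //= /bump /= add1n.
by case: n nm i => [|n] nm i; [case: i|rewrite subSS (leq_ltn_trans (leq_subr _ _))].
Qed.

Lemma qpoch_infE (a q : fps R) n N : q 0%N = 0 -> (n < N)%N ->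
  qpoch_inf a q n = (\prod_(i < N) (1 - a * q ^+ i)) n.
Proof.
move=> q0 nN.
have stable m : (n < m)%N ->
    (\prod_(i < m) (1 - a * q ^+ i)) n = (\prod_(i < n.+1) (1 - a * q ^+ i)) n.
  elim: m => // m IHm; rewrite ltnS leq_eqVlt => /predU1P[-> //|nm].
  rewrite [X in fps_coef X n]big_ord_recr [X in fps_coef X n]/= mulrBr mulr1 mulrA.
  rewrite -[LHS]/(fps_coef (\prod_(i < m) _) n - fps_coef _ n) IHm //.
  rewrite fps_coefM [X in _ - X]big1 ?subr0 // => i _.
  by rewrite fps_coefXn_small ?mulr0 // (leq_ltn_trans (leq_subr _ _)).
by apply: fps_limE; exists N => // m /= Nm; rewrite !stable // (leq_trans nN).
Qed.

Lemma qpoch_inf_unit : qpoch_inf fpsX fpsX \is a GRing.unit.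
Proof.
rewrite -[_ \is a _]/(qpoch_inf fpsX fpsX 0%N \is a GRing.unit).
rewrite (@qpoch_infE _ _ _ 1) // big_ord1 expr0 mulr1.
by rewrite -[fps_coef _ _]/(1 - 0) subr0 unitr1.
Qed.

Lemma genfunE (T : choiceType) (A : set T) (wt : T -> nat) n :
  finite_set (A `&` [set x | wt x = n]) ->
  genfun A wt n = (#|` fset_set (A `&` [set x | wt x = n])|)%fset%:R.
Proof.
move=> finA; rewrite /= -(@fsbig_widen _ _ _ _ (A `&` [set x | wt x = n])).
- rewrite fsbig_finite //= (eq_big_seq (fun=> 1)).
    by rewrite big_const_seq count_predT iter_addr_0.
  move=> x; rewrite in_fset_set // => /set_mem[_ /= <-].
  by rewrite fps_coefXn eqxx.
- by move=> x [].
- move=> x [Ax] /= nx; rewrite fps_coefXn eq_sym.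
  by case: eqP => // xn; case: nx.
Qed.

End FpsRing.

Arguments fpsX {R}.

Definition is_partition (l : seq nat) : bool := sorted geq l && (0%N \notin l).

(* [part l j] is the 1-indexed part l_j, which is 0 beyond the length of l. *)
Definition part (l : seq nat) (j : nat) : nat := nth 0%N l j.-1.

Definition cylindric_partitions (c : nat * nat) : set (seq nat * seq nat) :=
  [set L | [/\ is_partition L.1, is_partition L.2
    & forall j, (1 <= j)%N ->
        (part L.2 (j + c.2) <= part L.1 j)%N /\
        (part L.1 (j + c.1) <= part L.2 j)%N]].

Definition cyl_size (L : seq nat * seq nat) : nat := (sumn L.1 + sumn L.2)%N.

Lemma finite_partitions (n : nat) :
  finite_set [set l | is_partition l /\ (sumn l <= n)%N].
Proof.
pose g (f : {ffun 'I_n -> 'I_n.+1}) :=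
  [seq x <- [seq nat_of_ord (f i) | i <- enum 'I_n] | x != 0%N].
apply: (@sub_finite_set _ _ (g @` setT)); last exact: finite_image.
move=> l [/andP[_ l0] ln].
have size_le : (size l <= n)%N.
  apply: leq_trans ln; elim: l l0 => //= x l IHl.
  rewrite inE negb_or eq_sym -lt0n => /andP[x0 /IHl].
  by move=> H; rewrite -add1n leq_add.
have nth_le i : (nth 0%N l i < n.+1)%N.
  rewrite ltnS; apply: leq_trans ln; elim: l i {l0 size_le} => [|x l IHl] [|i] //=.
    exact: leq_addr.
  by rewrite (leq_trans (IHl i)) // leq_addl.
exists [ffun i : 'I_n => Ordinal (nth_le i)] => //; rewrite /g.
rewrite [map _ _](_ : _ = mkseq (nth 0%N l) n); last first.
  rewrite /mkseq -val_enum_ord -map_comp; apply: eq_map => i /=.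
  by rewrite ffunE.
rewrite -(subnKC size_le) /mkseq iotaD map_cat filter_cat.
rewrite -[map _ (iota 0 _)]/(mkseq _ _) mkseq_nth.
rewrite [X in _ ++ X](_ : _ = [::]) ?cats0.
  by apply/all_filterP/allP => x xl; apply: contraNneq l0 => <-.
apply/eqP; rewrite -[_ == _]negbK -has_filter; apply/hasPn => _ /mapP[i + ->].
by rewrite mem_iota negbK => /andP[il _]; rewrite nth_default.
Qed.

Lemma finite_cylindric_partitions (c : nat * nat) (n : nat) :
  finite_set (cylindric_partitions c `&` [set L | cyl_size L = n]).
Proof.
pose P := [set l | is_partition l /\ (sumn l <= n)%N].
apply: (@sub_finite_set _ _ (P `*` P)); last first.
  by apply: finite_setX; apply: finite_partitions.
move=> L [[p1 p2 _] /= Ln].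
by split; split=> //; rewrite -Ln /cyl_size ?leq_addr ?leq_addl.
Qed.

(* Main.v *)
Require Import Defs.
From mathcomp Require Import all_boot all_order all_algebra.
From mathcomp Require Import all_classical.
From mathcomp Require Import zify ring.
Import Order.TTheory GRing.Theory Num.Theory.
Local Open Scope ring_scope.

Set Implicit Arguments.
Unset Strict Implicit.
Unset Printing Implicit Defensive.

(** Let a and b be the numbers of parts of the two partitions of a cylindric
partition with profile (2, 0). The interlacing conditions force
b <= a <= b + 2, and removing 1 from every part (deleting the first column of
both Young diagrams) leaves a cylindric partition with the same profile.
Iterating, a cylindric partition is a multichain of nonzero points in the strip
b <= a <= b + 2, for the product order, and its size is the sum of the levels
a + b of the points visited. The strip has one point on each odd level 2k + 1,
namely (k+1, k), and two incomparable points on each positive even level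
2k + 2, namely (k+1, k+1) and (k+2, k); points on different levels are always
comparable. A multichain thus chooses freely a multiplicity for the point of
each odd level s, contributing 1 / (1 - q^s), and, on each even level s, at
most one of the two points with a positive multiplicity, contributing
1 + 2 q^s / (1 - q^s) = (1 + q^s) / (1 - q^s). The product of these factors
is the identity.

The argument is carried out one level at a time. Let H_N be the generating
function of the cylindric partitions with a + b <= N. Restoring the first
column ([add_column_bij]) shows that those with lengths exactly (a, b) are
q^(a+b) times those with lengths at most (a, b); the latter are the former
together with everything counted by H_(a+b-1) ([cyl20_fit_split]), because all
lower levels lie below (a, b). Hence (1 - q^N) H_N is H_(N-1) for N odd and (1
+ q^N) H_(N-1) for N even ([genfun_cyl20_len_odd], [genfun_cyl20_len_even]),
which gives the product for H_(2K) ([genfun_cyl20_len]). Each coefficient of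
H_N is eventually constant ([genfun_cyl20_stable]), so the identity holds in
the limit. *)

(** * Generating functions of weighted sets *)

Section GeneratingFunctions.
Variable R : comUnitRingType.
Local Notation q := (@fpsX R).

Lemma fps_addE (f g : fps R) n : (f + g) n = f n + g n.
Proof. by []. Qed.

Lemma fps_coefXnM k (f : fps R) n :
  (q ^+ k * f) n = if (k <= n)%N then f (n - k)%N else 0.
Proof.
rewrite fps_coefM; case: leqP => kn.
  rewrite (bigD1 (Ordinal (kn : (k < n.+1)%N))) //= fps_coefXn eqxx mul1r.
  rewrite big1 ?addr0 // => i ik.
  rewrite fps_coefXn (_ : (i : nat) == k = false) ?mul0r //.
  by apply: contraNF ik => /eqP ik; apply/eqP/val_inj.
rewrite big1 // => i _; rewrite fps_coefXn.
by rewrite (_ : (i : nat) == k = false) ?mul0r //; have := ltn_ord i; lia.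
Qed.

(** Restricting to the elements of weight n makes the sum finite in all cases
of interest, so that it can be split along a disjoint union. *)
Lemma genfun_coef (T : choiceType) (A : set T) (wt : T -> nat) n :
  genfun R A wt n =
    \sum_(x \in (A `&` [set x | wt x = n])%classic) (1 : R).
Proof.
rewrite /= -(@fsbig_widen _ _ _ _ (A `&` [set x | wt x = n])%classic).
- by apply: eq_fsbigr => x /set_mem[_ /= <-]; rewrite fps_coefXn eqxx.
- by move=> x [].
- move=> x [Ax] /= nx; rewrite fps_coefXn eq_sym.
  by case: eqP => // xn; case: nx.
Qed.

Lemma genfunU (T : choiceType) (A B : set T) (wt : T -> nat) :
    (forall n, finite_set (A `&` [set x | wt x = n])) ->
    (forall n, finite_set (B `&` [set x | wt x = n])) ->
    (A `&` B `<=` set0)%classic ->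
  genfun R (A `|` B)%classic wt = genfun R A wt + genfun R B wt.
Proof.
move=> finA finB AB0; apply: fpsP => n.
rewrite fps_addE !genfun_coef setIUl fsbigU0 //.
by move=> x [[Ax _] [Bx _]]; apply: (AB0 x).
Qed.

Lemma genfun_shift (T U : choiceType) (A : set T) (B : set U) (h : T -> U)
    (wtA : T -> nat) (wtB : U -> nat) k :
    set_bij A B h -> (forall x, A x -> wtB (h x) = (k + wtA x)%N) ->
  genfun R B wtB = q ^+ k * genfun R A wtA.
Proof.
move=> hbij wth; apply: fpsP => n; rewrite fps_coefXnM /=.
rewrite (reindex_fsbig h A B) //; case: leqP => kn.
  apply: eq_fsbigr => x /set_mem Ax; rewrite !fps_coefXn wth //.
  by congr (_%:R); lia.
apply: fsbig1 => x Ax; rewrite fps_coefXn wth //.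
by rewrite (_ : (n == _) = false) //; lia.
Qed.

Lemma genfun1 (T : choiceType) (x : T) (wt : T -> nat) :
  genfun R [set x] wt = q ^+ wt x.
Proof. by apply: fpsP => n /=; rewrite fsbig_set1. Qed.

End GeneratingFunctions.

(** * Partitions as functions *)

(** Reading entries with default value 0 turns partitions into weakly
decreasing functions that vanish eventually; lengths then need no separate
bookkeeping, since the length is the first zero. *)
Lemma is_partitionP l :
  reflect ((forall j, (nth 0%N l j.+1 <= nth 0%N l j)%N) /\
           (forall j, (j < size l)%N -> (0 < nth 0%N l j)%N))
          (is_partition l).
Proof.
apply: (iffP andP) => [[sl l0]|[dl pl]]; split.
- move=> j; have [jl|lj] := ltnP j.+1 (size l); last by rewrite nth_default.
  by move/(sortedP 0%N): sl; apply.
- move=> j jl; rewrite lt0n; apply: contraNneq l0 => <-; exact: mem_nth.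
- by apply/(sortedP 0%N) => j jl; apply: dl.
- by apply/negP => /(nthP 0%N)[j /pl + jE]; rewrite jE.
Qed.

Lemma nth_partition_eq0 l j :
  is_partition l -> (nth 0%N l j == 0)%N = (size l <= j)%N.
Proof.
move=> /is_partitionP[_ pl]; have [/pl|lj] := ltnP j (size l).
  by rewrite lt0n => /negbTE.
by rewrite nth_default.
Qed.

Lemma partition_ext l m :
  is_partition l -> is_partition m -> nth 0%N l =1 nth 0%N m -> l = m.
Proof.
move=> pl pm lm; apply: (@eq_from_nth _ 0%N) => [|j _]; last exact: lm.
apply/eqP; rewrite eqn_leq -!nth_partition_eq0 // -{1}lm lm.
by rewrite !nth_partition_eq0 // !leqnn.
Qed.

(** The first zero of f is where the partition is cut. *)
Lemma partition_of_fun (f : nat -> nat) a :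
    (forall j, (f j.+1 <= f j)%N) -> f a = 0%N ->
  exists2 l, is_partition l & nth 0%N l =1 f.
Proof.
move=> df fa; have ex0 : exists k, f k == 0%N by exists a; apply/eqP.
case: (ex_minnP ex0) => k /eqP fk kmin.
have fE : nth 0%N (mkseq f k) =1 f.
  move=> j; have [jk|kj] := ltnP j k; first by rewrite nth_mkseq.
  rewrite nth_default ?size_mkseq //.
  rewrite -(subnKC kj); elim: (j - k)%N => [|i IHi]; first by rewrite addn0.
  by rewrite addnS; apply/esym/eqP; rewrite -leqn0 [X in (_ <= X)%N]IHi.
exists (mkseq f k) => //; apply/is_partitionP; split=> j; rewrite !fE //.
rewrite size_mkseq => jk; rewrite lt0n; apply: contraTN jk => /kmin.
by rewrite -leqNgt.
Qed.

(** * Adding a column to a Young diagram *)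

(** The parts of l beyond its length count as 0, so the result always has
exactly a parts, provided that l has at most a of them. *)
Definition add_column (a : nat) (l : seq nat) : seq nat :=
  mkseq (fun j => (nth 0%N l j).+1) a.

Lemma nth_add_column a l j :
  nth 0%N (add_column a l) j = if (j < a)%N then (nth 0%N l j).+1 else 0%N.
Proof.
have [ja|aj] := ltnP j a; first by rewrite nth_mkseq.
by rewrite nth_default ?size_mkseq.
Qed.

Lemma add_column_partition a l :
  is_partition l -> is_partition (add_column a l).
Proof.
move=> /is_partitionP[dl _]; apply/is_partitionP; split=> j.
  by rewrite !nth_add_column; have := dl j; do 2?[case: ifP]; lia.
by rewrite size_mkseq nth_add_column => ->.
Qed.

Lemma sumn_add_column a l :
  (size l <= a)%N -> sumn (add_column a l) = (a + sumn l)%N.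
Proof.
elim: a l => [|a IHa] l la; first by case: l la.
have -> : add_column a.+1 l = (head 0%N l).+1 :: add_column a (behead l).
  rewrite /add_column /mkseq /= -(addn0 1%N) iotaDl -map_comp nth0.
  by congr cons; apply: eq_map => j /=; rewrite nth_behead.
rewrite /= IHa; last by rewrite size_behead; lia.
by case: l {la} => [|x l] /=; lia.
Qed.

(** * Cylindric partitions with profile (2, 0) *)

Definition cyl20 : set (seq nat * seq nat) := cylindric_partitions (2%N, 0%N).

Lemma cyl20P L :
  cyl20 L <-> [/\ is_partition L.1, is_partition L.2 &
    forall j, (nth 0%N L.2 j <= nth 0%N L.1 j)%N /\
              (nth 0%N L.1 j.+2 <= nth 0%N L.2 j)%N].
Proof.
split=> -[p1 p2 H]; split=> //.
  by move=> j; have := H j.+1 isT; rewrite /part /= addn0 addn2.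
by case=> // j _; have := H j; rewrite /part /= addn0 addn2.
Qed.

(** A vanishing entry forces the entry it dominates to vanish: the first
family of interlacing conditions is used at the first zero of L.1, the second
one at the first zero of L.2. *)
Lemma cyl20_strip L : cyl20 L -> (size L.2 <= size L.1 <= (size L.2).+2)%N.
Proof.
move=> /cyl20P[p1 p2 H]; apply/andP; split.
  by rewrite -nth_partition_eq0 // -leqn0; have [+ _] := H (size L.1);
     rewrite [X in (_ <= X)%N]nth_default.
rewrite -nth_partition_eq0 // -leqn0; have [_] := H (size L.2).
by rewrite [X in (_ <= X)%N]nth_default.
Qed.

(** All the classes that occur are cut out by a condition on the two lengths,
so that finiteness in each weight is proved only once. *)
Definition cyl20_with (P : nat -> nat -> bool) : set (seq nat * seq nat) :=
  [set L | cyl20 L /\ P (size L.1) (size L.2)]%classic.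

Definition cyl20_fit a b := cyl20_with (fun a' b' => (a' <= a) && (b' <= b))%N.
Definition cyl20_shape a b :=
  cyl20_with (fun a' b' => (a' == a) && (b' == b))%N.
Definition cyl20_len N := cyl20_with (fun a' b' => (a' + b' <= N)%N).

Lemma finite_cyl20_with P n :
  finite_set (cyl20_with P `&` [set L | cyl_size L = n]).
Proof.
by apply: sub_finite_set (finite_cylindric_partitions (2%N, 0%N) n) => L [[]].
Qed.

(** The strip condition on (a, b) is what keeps the interlacing true after the
columns are added: when the smaller side of an inequality gains 1, so must the
larger side, that is, j < b must imply j < a, and j + 2 < a must imply
j < b. *)
Lemma add_column_bij a b : (b <= a <= b.+2)%N ->
  set_bij (cyl20_fit a b) (cyl20_shape a b)
    (fun L => (add_column a L.1, add_column b L.2)).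
Proof.
move=> ab; split.
- move=> L [/cyl20P[p1 p2 H] /andP[la lb]].
  split; last by rewrite /= !size_mkseq !eqxx.
  apply/cyl20P; split; rewrite ?add_column_partition //= => j.
  by rewrite !nth_add_column; have [] := H j; do 3?[case: ifP]; lia.
- move=> L M /set_mem[/cyl20P[p1 p2 _] /andP[la lb]].
  move=> /set_mem[/cyl20P[q1 q2 _] /andP[ma mb]] [eq1 eq2].
  have add_column_inj c l m : (size l <= c)%N -> (size m <= c)%N ->
      add_column c l = add_column c m -> nth 0%N l =1 nth 0%N m.
    move=> lc mc /(congr1 (nth 0%N)) E j; have := congr1 (@^~ j) E.
    rewrite /= !nth_add_column; case: ltnP => [_ []//|cj _].
    by rewrite !nth_default // ?(leq_trans lc) ?(leq_trans mc).
  rewrite [L]surjective_pairing [M]surjective_pairing; congr (_, _).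
    by apply: partition_ext => //; apply: (add_column_inj a).
  by apply: partition_ext => //; apply: (add_column_inj b).
- move=> [l m] [/cyl20P[/= p1 p2 H] /= /andP[/eqP la /eqP mb]].
  (* Each component is lowered separately; the zeros created by removing 1 from
     the parts equal to 1 are dropped by [partition_of_fun]. *)
  have lower c k : is_partition k -> size k = c ->
      exists k', [/\ is_partition k', nth 0%N k' =1 (fun j => (nth 0%N k j).-1),
        (size k' <= c)%N & add_column c k' = k].
    move=> pk kc; have [dk _] := is_partitionP _ pk.
    have [||k' pk' k'E] := @partition_of_fun (fun j => (nth 0%N k j).-1) c.
    - by move=> j; have := dk j; lia.
    - by rewrite nth_default ?kc.
    exists k'; split=> //.
      by rewrite -nth_partition_eq0 // k'E nth_default ?kc.
    apply: (@eq_from_nth _ 0%N) => [|j]; rewrite size_mkseq // => jc.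
    rewrite nth_add_column jc k'E prednK // lt0n nth_partition_eq0 // kc.
    by rewrite -ltnNge.
  have [l' [pl' l'E l'a l'l]] := lower a l p1 la.
  have [m' [pm' m'E m'b m'm]] := lower b m p2 mb.
  exists (l', m') => /=; last by rewrite l'l m'm.
  split; last by rewrite l'a m'b.
  apply/cyl20P; split=> //= j.
  by rewrite !l'E !m'E; have := H j; lia.
Qed.

(** * Recurrence on the total number of parts *)

Section Recurrence.
Variable R : comUnitRingType.
Local Notation q := (@fpsX R).

Lemma genfun_cyl20_shape a b : (b <= a <= b.+2)%N ->
  genfun R (cyl20_shape a b) cyl_size =
    q ^+ (a + b) * genfun R (cyl20_fit a b) cyl_size.
Proof.
move=> ab; apply: (genfun_shift _ (add_column_bij ab)) => L [_ /andP[la lb]].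
by rewrite /cyl_size /= !sumn_add_column // addnACA.
Qed.

(** In the strip, every point of a lower level is below (a, b): a point with
one coordinate above that of (a, b) has the other one lower by at least 2, so
the differences of coordinates of the two points are at least 3 apart, whereas
in the strip they range over 0, 1, 2. *)
Lemma cyl20_fit_split a b : (b <= a <= b.+2)%N -> (0 < a + b)%N ->
  cyl20_fit a b = (cyl20_len (a + b).-1 `|` cyl20_shape a b)%classic.
Proof.
move=> ab ab0; apply/seteqP; split=> [L [CL lab]|L [[CL len]|[CL sh]]].
- have [sh|nsh] := boolP ((size L.1 == a) && (size L.2 == b)); [right|left];
    by split=> //; lia.
- by split=> //; have := cyl20_strip CL; lia.
- by split=> //; lia.
Qed.

Lemma genfun_cyl20_shape_len a b : (b <= a <= b.+2)%N -> (0 < a + b)%N ->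
  (1 - q ^+ (a + b)) * genfun R (cyl20_shape a b) cyl_size =
    q ^+ (a + b) * genfun R (cyl20_len (a + b).-1) cyl_size.
Proof.
move=> ab ab0; have := genfun_cyl20_shape ab.
rewrite cyl20_fit_split // genfunU; first by
  rewrite mulrDr mulrBl mul1r => {1}->; rewrite addrK.
all: try exact: finite_cyl20_with.
by move=> L [[_ ?] [_ ?]]; rewrite /set0 /=; lia.
Qed.

Lemma cyl20_len_odd k :
  cyl20_len k.*2.+1 = (cyl20_len k.*2 `|` cyl20_shape k.+1 k)%classic.
Proof.
apply/seteqP; split=> [L [CL len]|L [[CL len]|[CL sh]]].
- have := cyl20_strip CL => st.
  have [len'|len'] := leqP (size L.1 + size L.2) k.*2; [left|right];
    by split=> //; lia.
- by split=> //; lia.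
- by split=> //; lia.
Qed.

Lemma cyl20_len_even k :
  cyl20_len k.+1.*2 =
    (cyl20_len k.*2.+1 `|`
      (cyl20_shape k.+1 k.+1 `|` cyl20_shape k.+2 k))%classic.
Proof.
apply/seteqP; split=> [L [CL len]|L [[CL len]|[[CL sh]|[CL sh]]]].
- have := cyl20_strip CL => st.
  have [len'|len'] := leqP (size L.1 + size L.2) k.*2.+1; first by left.
  by have [e|e] := eqVneq (size L.1) k.+1; right; [left|right]; split=> //; lia.
all: by split=> //; lia.
Qed.

Lemma cyl20_len0 : cyl20_len 0 = [set ([::], [::])]%classic.
Proof.
apply/seteqP; split=> [[[|x l] [|y m]] [CL] //|_ ->].
by split=> //; apply/cyl20P; split=> // j; rewrite /= !nth_nil.
Qed.

(** On the odd level 2k + 1 the only point is (k+1, k). *)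
Lemma genfun_cyl20_len_odd k :
  (1 - q ^+ k.*2.+1) * genfun R (cyl20_len k.*2.+1) cyl_size =
    genfun R (cyl20_len k.*2) cyl_size.
Proof.
rewrite cyl20_len_odd genfunU; try exact: finite_cyl20_with; last first.
  by move=> L [[_ ?] [_ ?]]; rewrite /set0 /=; lia.
have kE : k.*2.+1 = (k.+1 + k)%N by lia.
rewrite mulrDr kE genfun_cyl20_shape_len; [|lia..].
by rewrite -kE /= mulrBl mul1r subrK.
Qed.

(** On the even level s = 2k + 2 there are the two points (k+1, k+1) and
(k+2, k), each adding q^s H_(s-1) / (1 - q^s); the total factor is
(1 - q^s + 2 q^s) / (1 - q^s). *)
Lemma genfun_cyl20_len_even k :
  (1 - q ^+ k.+1.*2) * genfun R (cyl20_len k.+1.*2) cyl_size =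
    (1 + q ^+ k.+1.*2) * genfun R (cyl20_len k.*2.+1) cyl_size.
Proof.
have finU n : finite_set ((cyl20_shape k.+1 k.+1 `|` cyl20_shape k.+2 k)
    `&` [set L | cyl_size L = n])%classic.
  by rewrite setIUl finite_setU; split; apply: finite_cyl20_with.
rewrite cyl20_len_even genfunU ?genfunU //; try exact: finite_cyl20_with;
  first last.
- by move=> L [[_ ?] [[_ ?]|[_ ?]]]; rewrite /set0 /=; lia.
- by move=> L [[_ ?] [_ ?]]; rewrite /set0 /=; lia.
rewrite !mulrDr.
have kE : k.+1.*2 = (k.+1 + k.+1)%N by lia.
have kE' : k.+1.*2 = (k.+2 + k)%N by lia.
rewrite {2}kE genfun_cyl20_shape_len -?kE; [|lia..].
rewrite {4}kE' genfun_cyl20_shape_len -?kE'; [|lia..].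
by rewrite doubleS /=; ring.
Qed.

Lemma genfun_cyl20_len K :
  genfun R (cyl20_len K.*2) cyl_size * \prod_(i < K.*2) (1 - q * q ^+ i) =
    \prod_(i < K) (1 - - q ^+ 2 * (q ^+ 2) ^+ i).
Proof.
elim: K => [|K IHK].
  by rewrite !big_ord0 cyl20_len0 genfun1 mulr1.
rewrite [RHS]big_ord_recr -IHK doubleS !big_ord_recr /= -!exprS -doubleS.
rewrite mulNr -exprM -exprD opprK -(genfun_cyl20_len_odd K).
have -> : (2 + 2 * K = K.+1.*2)%N by lia.
set P := \prod_(i < _) _; have E := genfun_cyl20_len_even K.
transitivity (P * (1 - q ^+ K.*2.+1) *
    ((1 - q ^+ K.+1.*2) * genfun R (cyl20_len K.+1.*2) cyl_size)).
  by ring.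
by rewrite E; ring.
Qed.

(** Parts are positive, so a cylindric partition of size n has at most n parts
in all. *)
Lemma genfun_cyl20_stable n N : (n <= N)%N ->
  genfun R cyl20 cyl_size n = genfun R (cyl20_len N) cyl_size n.
Proof.
move=> nN; rewrite !genfun_coef; congr (\sum_(x \in _) _).
apply/seteqP; split=> L [H Ln]; split=> //=; last by case: H.
have size_sumn l : is_partition l -> (size l <= sumn l)%N.
  move=> /is_partitionP[_]; elim: l => //= x l IHl pl.
  by have /= := pl 0%N isT; have := IHl (fun j => pl j.+1); lia.
split=> //; move: H Ln => /cyl20P[/size_sumn s1 /size_sumn s2 _].
by rewrite /= /cyl_size; lia.
Qed.

End Recurrence.

Theorem theorem7 :
  let q : fps int := fpsX in
  genfun int (cylindric_partitions (2%N, 0%N)) cyl_size =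
    qpoch_inf (- q ^+ 2) (q ^+ 2) / qpoch_inf q q.
Proof.
move=> q; apply: (canRL (mulrK (qpoch_inf_unit int))).
apply: fpsP => n; rewrite (@qpoch_infE _ _ _ n n.+1) //; last first.
  by rewrite fps_coefXn.
rewrite -genfun_cyl20_len !fps_coefM; apply: eq_bigr => i _.
(* The truncation level 2 (n + 1) matches n + 1 factors of the numerator with
   2 (n + 1) factors of the denominator, enough for all coefficients up to n. *)
rewrite (@genfun_cyl20_stable _ i n.+1.*2); last by have := ltn_ord i; lia.
by rewrite (@qpoch_infE _ _ _ _ n.+1.*2) //; lia.
Qed.
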